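(* Let $k$ be a field of characteristic zero, $R=k[x_1,\ldots,x_n]$, $f_1,\ldots,f_m\in R$, and let $P$ be the kernel of the $k$-algebra map $S=k[T_1,\ldots,T_m]\to R$, $T_j\mapsto f_j$. Let $\mathcal{P}$ and $\mathcal{Z}$ be the polar syzygy module and the differential syzygy module of $\mathbf{f}=\{f_1,\ldots,f_m\}$. Then $\operatorname{rank}_R(\mathcal{P})=\operatorname{rank}_R(\mathcal{Z})=\operatorname{height} P$.
   Context: The differential syzygy module is $\mathcal{Z}=\{(r_1,\ldots,r_m)\in R^m : \sum_{j} r_j\,\partial f_j/\partial x_i=0 \text{ for all } i=1,\ldots,n\}$, i.e. the first syzygy module of the differentials $df_1,\ldots,df_m\in\sum_{i=1}^n R\,dx_i$. The polar syzygy module $\mathcal{P}\subset\mathcal{Z}$ is the $R$-submodule of $R^m$ generated by the vectors $\left(\frac{\partial F}{\partial T_1}(\mathbf{f}),\ldots,\frac{\partial F}{\partial T_m}(\mathbf{f})\right)$, where $F$ runs through $P$ (equivalently, through a set of generators of $P$). The rank of an $R$-module $M$ is $\dim_{K}(M\otimes_R K)$, with $K$ the fraction field of $R$. *)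

(* Defs.v *)
From HB Require Import structures.
From mathcomp Require Import all_boot all_order all_algebra.
From mathcomp Require Import boolp.
From mathcomp Require Import mpoly.

Set Implicit Arguments.
Unset Strict Implicit.
Unset Printing Implicit Defensive.

Import GRing.Theory.
Local Open Scope ring_scope.

Section Submodules.
Variables (R : nzRingType) (V : lmodType R).

Record submodule (A : submodClosed V) :=
  Submodule { submodule_val : V; _ : submodule_val \in A }.

HB.instance Definition _ (A : submodClosed V) :=
  [isSub for @submodule_val A].
HB.instance Definition _ (A : submodClosed V) :=
  [Choice of submodule A by <:].
HB.instance Definition _ (A : submodClosed V) :=
  [SubChoice_isSubLmodule of submodule A by <:].

Definition gen_submod (G : V -> Prop) : {pred V} :=
  fun v => `[< exists2 s : seq (R * V),
                 forall a, a \in s -> G a.2 & v = \sum_(a <- s) a.1 *: a.2 >].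

Lemma gen_submod_closed G : submod_closed (gen_submod G).
Proof.
split; first by apply/asboolP; exists [::] => //; rewrite big_nil.
move=> c u v /asboolP[s Gs ->] /asboolP[t Gt ->]; apply/asboolP.
exists ([seq (c * a.1, a.2) | a <- s] ++ t).
  move=> a; rewrite mem_cat => /orP[/mapP[b bs ->]|]; first exact: (Gs b).
  exact: Gt.
rewrite big_cat big_map scaler_sumr; congr (_ + _).
by apply: eq_bigr => a _; rewrite scalerA.
Qed.

HB.instance Definition _ G :=
  GRing.isSubmodClosed.Build R V (gen_submod G) (gen_submod_closed G).

End Submodules.

Section Rank.
Variable R : idomainType.
Local Notation K := {fraction R}.

Definition balanced (M : lmodType R) (W : zmodType) (b : M -> K -> W) : Prop :=
  [/\ forall x y c, b (x + y) c = b x c + b y c,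
      forall x c d, b x (c + d) = b x c + b x d
    & forall (r : R) x c, b (r *: x) c = b x (tofrac r * c)].

(* (V, t) is the tensor product M (x)_R K with its canonical K-vector space
   structure, t x c being the pure tensor x (x) c. *)
Definition is_tensor_frac (M : lmodType R) (V : lmodType K)
    (t : M -> K -> V) : Prop :=
  [/\ balanced t,
      forall a x c, t x (a * c) = a *: t x c
    & forall (W : zmodType) (b : M -> K -> W), balanced b ->
        exists2 h : {additive V -> W},
          forall x c, h (t x c) = b x c
        & forall h' : {additive V -> W},
            (forall x c, h' (t x c) = b x c) -> h' =1 h].

(* A relation rather than a function, as M (x)_R K is only determined up to
   isomorphism and need not be finite dimensional. *)
Definition has_rank (M : lmodType R) (d : nat) : Prop :=
  exists (V : vectType K) (t : M -> K -> V),
    is_tensor_frac t /\ \dim {:V} = d.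

End Rank.

Section Height.
Variable S : comNzRingType.

Definition prime_chain_to (I : {pred S}) (h : nat) : Prop :=
  exists c : 'I_h.+1 -> prime_idealr S,
    (forall i j : 'I_h.+1, (i < j)%N ->
       {subset c i <= c j} /\ ~ {subset c j <= c i})
    /\ c ord_max =i I.

(* The height of a prime ideal; no h qualifies when I is not prime. *)
Definition has_height (I : {pred S}) (h : nat) : Prop :=
  prime_chain_to I h /\ forall h', prime_chain_to I h' -> (h' <= h)%N.

End Height.

Section Syzygies.
Variables (k : fieldType) (n m : nat) (f : m.-tuple {mpoly k[n]}).
Local Notation R := {mpoly k[n]}.
Local Notation S := {mpoly k[m]}.

Definition relation_ideal : {pred S} := fun F => comp_mpoly f F == 0.

Definition diff_syz : {pred 'rV[R]_m} :=
  fun r => [forall i : 'I_n, \sum_(j < m) r 0 j * mderiv i (tnth f j) == 0].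

Definition polar_vec (F : S) : 'rV[R]_m :=
  \row_(j < m) comp_mpoly f (mderiv j F).

Definition polar_syz : {pred 'rV[R]_m} :=
  gen_submod (fun v => exists2 F, F \in relation_ideal & v = polar_vec F).

Lemma diff_syz_closed : submod_closed diff_syz.
Proof.
split; first by apply/forallP => i; rewrite big1 // => j _; rewrite mxE mul0r.
move=> c u v /forallP Zu /forallP Zv; apply/forallP => i.
rewrite (eq_bigr (fun j => c * (u 0 j * mderiv i (tnth f j))
                           + v 0 j * mderiv i (tnth f j))); last first.
  by move=> j _; rewrite !mxE mulrDl mulrA.
by rewrite big_split /= -mulr_sumr (eqP (Zu i)) (eqP (Zv i)) mulr0 addr0.
Qed.

HB.instance Definition _ :=
  GRing.isSubmodClosed.Build R 'rV[R]_m diff_syz diff_syz_closed.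
HB.instance Definition _ := GRing.SubmodClosed.on polar_syz.

End Syzygies.

(* Main.v *)
Require Import Defs.
From HB Require Import structures.
From mathcomp Require Import all_boot all_order all_algebra.
From mathcomp Require Import boolp mpoly ring zify.

(** Choose a maximal set [B] of indices such that the [f_j], [j \in B], are
    algebraically independent over [k].  All three numbers equal [m - #|B|].

    Ranks.  For [v \notin B] the maximality of [B] yields a relation among
    [f_v] and the [f_j], [j \in B]; one of least degree, [G_v], satisfies
    [(dG_v/dT_v)(f) != 0]: this derivative has smaller degree, and it is not the
    zero polynomial because [G_v] involves [T_v] and the characteristic is zero
    ([minimal_relation]).  In the columns outside [B] the polar vectors of the
    [G_v] form a diagonal matrix with nonzero diagonal entries, so they are
    [m - #|B|] independent polar syzygies.  By the chain rule polar syzygies are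
    differential syzygies, and these lie in the kernel of the Jacobian matrix
    over the fraction field.  It remains to see that this matrix has rank at
    least [#|B|] ([jacobian_rank]), for then the kernel has no room for more.
    Extend the [f_j], [j \in B], to a maximal independent subfamily of
    [f_1, .., f_m, x_1, .., x_n].  Minimal relations, differentiated, show that
    the differentials of this subfamily span all the [dx_i]; it has at most [n]
    members ([indep_mod_card]), hence at most [n - #|B|] besides the [f_j],
    [j \in B], so the [df_j] span a space of dimension at least [#|B|].

    Height, upper bound ([prime_chain_le]).  Given primes
    [c_0 < .. < c_h = P], pick [g_i] in [c_i] but not in [c_(i-1)].  If a family
    is independent modulo [c_i], then together with [g_i] it is independent
    modulo [c_(i-1)] ([indep_mod_adjoin]).  So the [T_j], [j \in B], and the [g_i]
    are independent in [k[T_1, .., T_m]], and [#|B| + h <= m].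

    Height, lower bound ([prime_chain_ex]).  For a set [A] of indices let [P_A]
    be the kernel of the map sending [T_j] to [f_j] for [j \in A] and to a new
    variable [Z_j] otherwise.  It is prime, it grows with [A], it is [P] when
    [A] is everything, and [G_v] separates [P_A] from [P_A'] whenever
    [v \in A' :\: A] and [B \subset A'], because differentiating in [Z_v] shows
    that [P_A] is stable under [d/dT_v].  Adding the [m - #|B|] indices outside
    [B] one at a time gives the chain. *)

Set Implicit Arguments.
Unset Strict Implicit.
Unset Printing Implicit Defensive.

Import GRing.Theory.
Local Open Scope ring_scope.

(** * Substitution and partial derivatives *)

Section Substitution.
Variable k : comNzRingType.

Lemma mpoly_alg_ind (N : nat) (P : {mpoly k[N]} -> Prop) :
  (forall c, P c%:MP) -> (forall i, P 'X_i) ->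
  (forall p q, P p -> P q -> P (p + q)) ->
  (forall p q, P p -> P q -> P (p * q)) -> forall p, P p.
Proof.
move=> PC PX PD PM p; rewrite [p]mpolyE.
apply: (big_ind P) => [||m _]; [exact: (PC 0) | exact: PD |].
rewrite -mul_mpolyC; apply: (PM) => //; rewrite mpolyXE_id.
apply: (big_ind P) => [||i _]; [exact: (PC 1) | exact: PM |].
elim: (m i) => [|e IHe]; first exact: (PC 1).
by rewrite exprS; apply: PM.
Qed.

Lemma mderiv_var (N : nat) (i j : 'I_N) :
  ('X_i)^`M(j) = (i == j)%:R :> {mpoly k[N]}.
Proof.
rewrite mderivX mnm1E; case: eqP => [->|_]; last by rewrite scale0r.
have -> : (U_(j) - U_(j) = 0)%MM by apply/mnmP => l; rewrite !mnmE subnn.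
by rewrite scale1r mpolyX0.
Qed.

Lemma comp_mpoly_var (N n : nat) (u : N.-tuple {mpoly k[n]}) i :
  'X_i \mPo u = tnth u i.
Proof. by rewrite comp_mpolyXU (tnth_nth 0). Qed.

Lemma mderiv_comp (N n : nat) (u : N.-tuple {mpoly k[n]}) i (F : {mpoly k[N]}) :
  (F \mPo u)^`M(i) = \sum_j (F^`M(j) \mPo u) * (tnth u j)^`M(i).
Proof.
elim/mpoly_alg_ind: F => [c|l|p q IHp IHq|p q IHp IHq].
- by rewrite comp_mpolyC mderivC big1 // => j _; rewrite mderivC comp_mpoly0 mul0r.
- rewrite comp_mpoly_var (bigD1 l) //= big1 ?addr0 => [|j jl]; rewrite mderiv_var.
    by rewrite eqxx comp_mpoly1 mul1r.
  by rewrite eq_sym (negPf jl) comp_mpoly0 mul0r.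
- rewrite comp_mpolyD mderivD IHp IHq -big_split /=.
  by apply: eq_bigr => j _; rewrite mderivD comp_mpolyD mulrDl.
rewrite rmorphM mderivM IHp IHq mulr_suml mulr_sumr -big_split /=.
apply: eq_bigr => j _; rewrite mderivM comp_mpolyD !rmorphM /=; ring.
Qed.

Lemma comp_comp_mpoly (N m n : nat) (v : N.-tuple {mpoly k[m]})
    (u : m.-tuple {mpoly k[n]}) (F : {mpoly k[N]}) :
  (F \mPo v) \mPo u = F \mPo [tuple tnth v i \mPo u | i < N].
Proof.
elim/mpoly_alg_ind: F => [c|i|p q IHp IHq|p q IHp IHq].
- by rewrite !comp_mpolyC.
- by rewrite !comp_mpoly_var tnth_mktuple.
- by rewrite !comp_mpolyD IHp IHq.
by rewrite !rmorphM /= IHp IHq.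
Qed.

End Substitution.

(** * Polynomials in some of the variables *)

Section Supported.
Variables (k : nzRingType) (N : nat).
Implicit Types (D E : {set 'I_N}) (F : {mpoly k[N]}).

(** Over a field of characteristic zero this says that only the variables
    indexed by [D] occur in [F] ([supported_msupp]).  Phrased with derivatives,
    the condition visibly passes from [F] to its derivatives. *)
Definition supported D F : Prop := forall j, j \notin D -> F^`M(j) = 0.

Lemma supportedX D (e : 'X_{1..N}) :
  (forall j, j \notin D -> e j = 0%N) -> supported D 'X_[k, e].
Proof. by move=> eD j jD; rewrite mderivX eD // scale0r. Qed.

Lemma supported_lin D (I : Type) (r : seq I) (P : pred I) (c : I -> k)
    (F : I -> {mpoly k[N]}) :
  (forall i, P i -> supported D (F i)) ->
  supported D (\sum_(i <- r | P i) c i *: F i).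
Proof.
move=> DF j jD; rewrite linear_sum /= big1 // => i Pi.
by rewrite linearZ /= DF // scaler0.
Qed.

Lemma supported_mderiv D i F : supported D F -> supported D F^`M(i).
Proof. by move=> DF j jD; rewrite mderiv_comm DF // linear0. Qed.

Lemma supportedS D E F : D \subset E -> supported D F -> supported E F.
Proof. by move=> DE DF j jE; apply: DF; apply: contra jE; apply/subsetP. Qed.

Lemma supportedT F : supported setT F.
Proof. by move=> j; rewrite inE. Qed.

End Supported.

Section SupportedCharZero.
Variables (k : fieldType) (pchar0 : [pchar k]%R =i pred0).

Lemma supported_msupp (N : nat) (D : {set 'I_N}) (F : {mpoly k[N]}) e j :
  supported D F -> e \in msupp F -> j \notin D -> e j = 0%N.
Proof.
move=> DF eF jD; apply/eqP; rewrite -leqn0 leqNgt; apply/negP => ej.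
have := congr1 (mcoeff (e - U_(j))) (DF j jD).
rewrite mcoeff_mderiv mcoeff0 submK; last first.
  by apply/mnm_lepP => i; rewrite mnm1E; case: eqP => // <-.
move/eqP; rewrite -mulr_natl mulf_eq0 (proj1 (pcharf0P k) pchar0) /=.
by rewrite mcoeff_eq0 eF.
Qed.

Lemma supported_eq_comp (N n : nat) (D : {set 'I_N}) (F : {mpoly k[N]})
    (u v : N.-tuple {mpoly k[n]}) :
  supported D F -> (forall j, j \in D -> tnth u j = tnth v j) ->
  F \mPo u = F \mPo v.
Proof.
move=> DF uv; rewrite !comp_mpolyE; apply: eq_big_seq => e eF.
congr (_ *: _); apply: eq_bigr => j _.
by have [/uv ->|jD] := boolP (j \in D); last rewrite (supported_msupp DF eF jD).
Qed.

End SupportedCharZero.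

(** * Algebraic independence modulo a set of polynomials *)

Section Independence.
Variables (k : nzRingType) (N : nat) (Q : {pred {mpoly k[N]}}).
Implicit Types D : {set 'I_N}.

(** For an ideal [Q] over a field of characteristic zero: the classes modulo [Q]
    of the variables indexed by [D] are algebraically independent.  For
    [Q = relation_ideal u] this is the algebraic independence of the [u_j],
    [j \in D].  Keeping the number of variables fixed and varying [D] avoids
    renumbering them. *)
Definition indep_mod D : Prop := forall F, F \in Q -> supported D F -> F = 0.

Lemma indep_mod_maximal D : indep_mod D ->
  exists E : {set 'I_N}, [/\ D \subset E, indep_mod E
    & forall v, v \notin E -> ~ indep_mod (v |: E)].
Proof.
move=> /asboolP indD.
have [E /maxsetP[/asboolP indE maxE] DE] :=
  @maxset_exists _ (fun E : {set 'I_N} => `[< indep_mod E >]) _ indD.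
exists E; split=> // v vE /asboolP indvE.
by case/negP: vE; rewrite -(maxE _ indvE (subsetUr _ _)) setU11.
Qed.

(** Among the nonzero elements of [Q] in the variables [v |: D], one of least
    degree works: its derivative in [X_v] is of smaller degree, and were it zero,
    the polynomial would be supported on [D], against the independence of [D]. *)
Lemma minimal_relation D v : indep_mod D -> ~ indep_mod (v |: D) ->
  exists G, [/\ G \in Q, supported (v |: D) G & G^`M(v) \notin Q].
Proof.
move=> indD depD.
have [F [QF DF F0]] : exists F, [/\ F \in Q, supported (v |: D) F & F != 0].
  apply: contrapT => noF; apply: depD => F QF DF; apply/eqP/negPn/negP => F0.
  by apply: noF; exists F.
have [b Fb] := ubnP (msize F); elim: b => // b IHb in F QF DF F0 Fb *.
move: Fb; rewrite ltnS => Fb; have [Fv|Fv] := eqVneq F^`M(v) 0.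
  case/eqP: F0; apply: indD => // j jD; have [->//|jv] := eqVneq j v.
  by apply: DF; rewrite !inE negb_or jv.
have [QFv|] := boolP (F^`M(v) \in Q); last by exists F.
apply: (IHb F^`M(v)) => //; first exact: supported_mderiv.
apply: leq_trans Fb; rewrite -(mlead_deg Fv).
have: mlead F^`M(v) \in msupp F^`M(v) by rewrite mlead_supp.
rewrite mcoeff_msupp mcoeff_mderiv => cF.
have: (mlead F^`M(v) + U_(v))%MM \in msupp F.
  by rewrite mcoeff_msupp; apply: contra cF => /eqP ->; rewrite mul0rn.
by move/msize_mdeg_lt; rewrite mdegD mdeg1 addn1.
Qed.

End Independence.

(** Write a relation [F] modulo [Q] as [F0 + X_v * F1] with [F0] free of [X_v].
    Modulo the larger [Q'], where [X_v] vanishes, only [F0] remains, so [F0 = 0];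
    then [X_v] can be cancelled modulo the prime [Q], and [F1] is a relation of
    smaller degree. *)
Lemma indep_mod_adjoin (k : fieldType) (pchar0 : [pchar k]%R =i pred0)
    (S : comNzRingType) (N : nat) (phi : {rmorphism {mpoly k[N]} -> S})
    (Q Q' : prime_idealr S) (D : {set 'I_N}) v :
  {subset Q <= Q'} -> phi 'X_v \in Q' -> phi 'X_v \notin Q ->
  indep_mod [preim phi of Q'] D -> indep_mod [preim phi of Q] (v |: D).
Proof.
move=> QQ' Xv' Xv indD F.
have [b] := ubnP (msize F); elim: b => // b IHb in F * => Fb; rewrite inE => QF DF.
pose F0 : {mpoly k[N]} := \sum_(e <- msupp F | e v == 0%N) F@_e *: 'X_[e].
pose F1 : {mpoly k[N]} := \sum_(e <- msupp F | e v != 0%N) F@_e *: 'X_[e - U_(v)].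
have EF : F = F0 + 'X_v * F1.
  rewrite {1}[F]mpolyE (bigID (fun e : 'X_{1..N} => e v == 0%N)) /=.
  congr (_ + _); rewrite mulr_sumr; apply: eq_bigr => e ev.
  rewrite -scalerAr -mpolyXD addmC submK //.
  by apply/mnm_lepP => i; rewrite mnm1E; case: eqP => // <-; rewrite lt0n.
have sF0 : supported D F0.
  rewrite /F0 big_seq_cond; apply: supported_lin => e /andP[eF /eqP ev].
  apply: supportedX => j jD; have [->//|jv] := eqVneq j v.
  by apply: (supported_msupp pchar0 DF eF); rewrite !inE negb_or jv.
have sF1 : supported (v |: D) F1.
  rewrite /F1 big_seq_cond; apply: supported_lin => e /andP[eF ev].
  apply: supportedX => j jD; rewrite mnmBE.
  by rewrite (supported_msupp pchar0 DF eF) // sub0n.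
have F0_0 : F0 = 0.
  apply: indD => //; rewrite inE; have -> : F0 = F - 'X_v * F1 by rewrite EF addrK.
  by rewrite rmorphB rpredB //; [apply: QQ' | rewrite rmorphM mulrC idealMr].
move: EF; rewrite F0_0 add0r => EF.
move: (QF); rewrite EF rmorphM prime_idealrM (negPf Xv) /= => QF1.
have [->|F1_0] := eqVneq F1 0; first by rewrite mulr0.
suff F1z : F1 = 0 by rewrite F1z eqxx in F1_0.
apply: IHb => //; move: Fb.
have Xv0 : 'X_v != 0 :> {mpoly k[N]} by rewrite -msize_poly_eq0 msizeX.
by rewrite {1}EF msizeM // msizeX mdeg1.
Qed.

(** * At most n independent polynomials in n variables *)

Lemma msize_prod_le (k : idomainType) (n : nat) (I : Type) (r : seq I)
    (F : I -> {mpoly k[n]}) (a : I -> nat) :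
  (forall i, msize (F i) <= (a i).+1)%N ->
  (msize (\prod_(i <- r) F i) <= (\sum_(i <- r) a i).+1)%N.
Proof.
move=> Fa; elim/big_rec2: _ => [|i b p _ pb]; first by rewrite msize1.
have [->|F0] := eqVneq (F i) 0; first by rewrite mul0r msize0.
have [->|p0] := eqVneq p 0; first by rewrite mulr0 msize0.
by rewrite msizeM // -subn1 leq_subLR add1n -addSn -addnS leq_add.
Qed.

Lemma msize_exp_le (k : idomainType) (n : nat) (F : {mpoly k[n]}) a e :
  (msize F <= a.+1)%N -> (msize (F ^+ e) <= (e * a).+1)%N.
Proof.
move=> Fa; have -> : F ^+ e = \prod_(i < e) F by rewrite prodr_const card_ord.
by rewrite (leq_trans (msize_prod_le _ (fun=> Fa))) // sum_nat_const card_ord.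
Qed.

Lemma left_kernel_neq0 (k : fieldType) (a b : nat) (M : 'M[k]_(a, b)) :
  (b < a)%N -> exists2 c : 'rV_a, c != 0 & c *m M = 0.
Proof.
move=> ba; have: kermx M != 0.
  rewrite -mxrank_eq0 mxrank_ker subn_eq0 -ltnNge.
  exact: leq_ltn_trans (rank_leq_col M) ba.
by case/rowV0Pn => c /sub_kermxP cM c0; exists c.
Qed.

(** A polynomial in [d] of degree [n] is eventually below [d ^ s] for [s > n]. *)
Lemma box_count (s n E : nat) : (n < s)%N ->
  exists d, ((s * d * E).+1 ^ n < d ^ s)%N.
Proof.
move=> ns; pose C := ((s * E).+1 ^ n)%N; exists C.+1.
apply: (@leq_trans (C.+1 ^ n.+1)); last by rewrite leq_pexp2l.
apply: (@leq_ltn_trans (C.+1 ^ n * C)).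
  rewrite -expnMn; case: (n) => // l; rewrite leq_exp2r //; nia.
by rewrite expnSr ltn_pmul2l ?expn_gt0.
Qed.

Section Counting.
Variables (k : fieldType) (N n : nat) (u : N.-tuple {mpoly k[n]}).
Variable D : {set 'I_N}.

Let mon d (e : {ffun 'I_#|D| -> 'I_d}) : 'X_{1..N} :=
  (\sum_i U_(enum_val i) *+ e i)%MM.

Let mon_val d (e : {ffun 'I_#|D| -> 'I_d}) i : mon e (enum_val i) = e i.
Proof.
rewrite mnm_sumE (bigD1 i) //= big1 => [|j ji].
  by rewrite addn0 mulmnE mnm1E eqxx mul1n.
by rewrite mulmnE mnm1E (inj_eq enum_val_inj) (negPf ji).
Qed.

Let mon_out d (e : {ffun 'I_#|D| -> 'I_d}) j : j \notin D -> mon e j = 0%N.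
Proof.
move=> jD; rewrite mnm_sumE big1 // => i _; rewrite mulmnE mnm1E.
by case: eqP jD => [<-|//]; rewrite enum_valP.
Qed.

(** If [#|D| > n], then for large [d] there are more monomials in the variables
    of [D] with exponents below [d] than monomials that can occur once [u] is
    substituted in them, hence a linear relation between the results. *)
Lemma indep_mod_card : indep_mod (relation_ideal u) D -> (#|D| <= n)%N.
Proof.
move=> indD; rewrite leqNgt; apply/negP => nD.
pose E := (\max_j msize (tnth u j))%N.
have [d dn] := box_count E nD; set L := (#|D| * d * E).+1 in dn.
have szmon (e : {ffun 'I_#|D| -> 'I_d}) : (msize ('X_[mon e] \mPo u) <= L)%N.
  rewrite comp_mpolyX; pose a j := (mon e j * E)%N.
  have ja j : (msize (tnth u j ^+ mon e j) <= (a j).+1)%N.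
    by apply: msize_exp_le; rewrite leqW // /E; apply: leq_bigmax.
  apply: leq_trans (msize_prod_le _ ja) _.
  rewrite ltnS -big_distrl /= -mdegE leq_mul2r; apply/orP; right.
  rewrite mdeg_sum; apply: (@leq_trans (\sum_(i < #|D|) d)); last first.
    by rewrite sum_nat_const card_ord.
  by apply: leq_sum => i _; rewrite mdegMn mdeg1 mul1n ltnW.
pose I := {ffun 'I_#|D| -> 'I_d}; pose J := {ffun 'I_n -> 'I_L}.
pose M : 'M[k]_(#|{:I}|, #|{:J}|) := \matrix_(a, b)
  ('X_[mon (enum_val a : I)] \mPo u)@_[multinom ((enum_val b : J) i : nat) | i < n].
have [|c c0 cM] := left_kernel_neq0 M; first by rewrite !card_ffun !card_ord.
pose F : {mpoly k[N]} := \sum_a c 0 a *: 'X_[mon (enum_val a : I)].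
have F0 : F = 0.
  apply: indD; last first.
    by apply: supported_lin => a _; apply: supportedX; apply: mon_out.
  apply/eqP/mpolyP => e; rewrite mcoeff0 /F (raddf_sum (comp_mpoly u)) raddf_sum /=.
  (* the columns of M cover the exponents below L; the others cannot occur *)
  have [/forallP eL|] := boolP [forall i, e i < L]%N.
    pose b : J := [ffun i => Ordinal (eL i)].
    have := congr1 (fun A : 'rV_#|{:J}| => A 0 (enum_rank b)) cM.
    rewrite !mxE; apply: etrans; apply: eq_bigr => a _.
    rewrite comp_mpolyZ mcoeffZ mxE enum_rankK; congr (_ * _@__).
    by apply/mnmP => i; rewrite mnmE ffunE.
  rewrite negb_forall => /existsP[i]; rewrite -leqNgt => Le.
  rewrite big1 // => a _; rewrite comp_mpolyZ mcoeffZ.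
  rewrite [X in _ * X]memN_msupp_eq0 ?mulr0 //; apply: msize_mdeg_ge.
  rewrite (leq_trans (szmon _)) // (leq_trans Le) //.
  by rewrite mdegE (bigD1 i) //= leq_addr.
case/eqP: c0; apply/rowP => a; rewrite mxE.
have := congr1 (mcoeff (mon (enum_val a : I))) F0; rewrite mcoeff0 => <-.
rewrite /F raddf_sum (bigD1 a) //= mcoeffZ mcoeffX eqxx mulr1.
rewrite big1 ?addr0 // => b ba; rewrite mcoeffZ mcoeffX.
case: eqP => [Eab|]; last by rewrite mulr0.
case/eqP: ba; apply: enum_val_inj; apply/ffunP => i; apply: val_inj => /=.
by rewrite -!mon_val Eab.
Qed.

End Counting.

(** * Chains of primes below the ideal of relations *)

Section RelationIdeal.
Variables (k : fieldType) (N n : nat) (u : N.-tuple {mpoly k[n]}).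

Lemma relation_ideal_idealr : idealr_closed (relation_ideal u).
Proof.
split=> [||a x y /eqP x0 /eqP y0]; apply/eqP; first exact: comp_mpoly0.
  by rewrite comp_mpoly1; apply/eqP; rewrite oner_eq0.
by rewrite comp_mpolyD rmorphM /= x0 y0 mulr0 addr0.
Qed.

Lemma relation_ideal_prime : prime_idealr_closed (relation_ideal u).
Proof. by move=> x y; rewrite !unfold_in rmorphM mulf_eq0. Qed.

HB.instance Definition _ :=
  isIdealr.Build {mpoly k[N]} (relation_ideal u) relation_ideal_idealr.
HB.instance Definition _ :=
  isPrimeIdealrClosed.Build {mpoly k[N]} (relation_ideal u) relation_ideal_prime.
End RelationIdeal.

Section Height.
Variables (k : fieldType) (pchar0 : [pchar k]%R =i pred0).

Lemma indep_mod_lshift (m h n : nat) (f : m.-tuple {mpoly k[n]})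
    (g : h.-tuple {mpoly k[n]}) (B : {set 'I_m}) :
  indep_mod (relation_ideal f) B ->
  indep_mod (relation_ideal (cat_tuple f g)) (lshift h @: B).
Proof.
move=> indB F /eqP Ffg DF.
(* F only involves the first m variables: rename them to get rid of the others *)
pose rho := cat_tuple [tuple 'X_i | i < m] [tuple (0 : {mpoly k[m]}) | i < h].
pose lam : m.-tuple {mpoly k[m + h]} := [tuple 'X_(lshift h i) | i < m].
have rhoL i : tnth rho (lshift h i) = 'X_i by rewrite tnth_lshift tnth_mktuple.
have sF' : supported B (F \mPo rho).
  move=> i iB; rewrite mderiv_comp big_split_ord /= [X in _ + X]big1 => [|j _].
    rewrite addr0 (bigD1 i) //= DF ?comp_mpoly0 ?mul0r ?add0r ?big1 // => [j ji|].
      by rewrite rhoL mderiv_var (negPf ji) mulr0.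
    by rewrite mem_imset //; apply: lshift_inj.
  by rewrite tnth_rshift tnth_mktuple mderiv0 mulr0.
have F'0 : F \mPo rho = 0.
  apply: indB => //; apply/eqP; rewrite comp_comp_mpoly -[RHS]Ffg.
  apply: (supported_eq_comp pchar0 DF) => j /imsetP[i _ ->].
  by rewrite tnth_mktuple rhoL comp_mpoly_var tnth_lshift.
have -> : F = (F \mPo rho) \mPo lam.
  rewrite comp_comp_mpoly -[LHS]comp_mpoly_id.
  apply: (supported_eq_comp pchar0 DF) => j /imsetP[i _ ->].
  by rewrite 2!tnth_mktuple rhoL comp_mpoly_var tnth_mktuple.
by rewrite F'0 comp_mpoly0.
Qed.

Lemma prime_chain_le (m n h : nat) (f : m.-tuple {mpoly k[n]}) (B : {set 'I_m}) :
  indep_mod (relation_ideal f) B ->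
  prime_chain_to (relation_ideal f) h -> (#|B| + h <= m)%N.
Proof.
move=> indB [c [c_incr c_top]].
have /choice[g cg] : forall i : 'I_h, exists x,
    x \in c (lift ord0 i) /\ x \notin c (widen_ord (leqnSn h) i).
  move=> i; have [|_ ncc] := c_incr (widen_ord (leqnSn h) i) (lift ord0 i).
    by rewrite /= /bump.
  apply: contrapT => no; apply: ncc => x xc; apply/negPn/negP => xn.
  by apply: no; exists x.
pose w := cat_tuple [tuple 'X_i | i < m] [tuple g i | i < h].
have wR i : 'X_(rshift m i) \mPo w = g i.
  by rewrite comp_mpoly_var tnth_rshift tnth_mktuple.
pose D t := lshift h @: B :|: (@rshift m h) @: [set i : 'I_h | t <= i]%N.
have indD s : (s <= h)%N ->
    indep_mod [preim comp_mpoly w of c (inord (h - s))] (D (h - s)%N).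
  elim: s => [_|s IHs sh].
    have -> : D (h - 0)%N = lshift h @: B.
      rewrite /D (_ : [set i : 'I_h | _] = set0) ?imset0 ?setU0 //.
      by apply/setP => i; rewrite !inE subn0 leqNgt ltn_ord.
    have -> : inord (h - 0) = ord_max :> 'I_h.+1.
      by apply: val_inj; rewrite /= inordK subn0.
    move=> F; rewrite inE c_top => /eqP Fw sF.
    apply: (indep_mod_lshift (g := [tuple g i \mPo f | i < h]) indB) sF.
    apply/eqP; rewrite -[RHS]Fw comp_comp_mpoly; congr comp_mpoly.
    apply: eq_from_tnth => j; rewrite [RHS]tnth_mktuple; case: (split_ordP j) => i ->.
      by rewrite !tnth_lshift tnth_mktuple comp_mpoly_var.
    by rewrite !tnth_rshift !tnth_mktuple.
  have hsh : (h - s.+1 < h)%N by lia.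
  pose i := Ordinal hsh.
  have -> : D (h - s.+1)%N = rshift m i |: D (h - s)%N.
    rewrite /D setUCA -imsetU1.
    have -> // : [set j : 'I_h | h - s.+1 <= j]%N = i |: [set j : 'I_h | h - s <= j]%N.
    by apply/setP => j; rewrite !inE -val_eqE /=; lia.
  have Ei : widen_ord (leqnSn h) i = inord (h - s.+1).
    by apply: val_inj; rewrite /= inordK //; lia.
  have Ei1 : lift ord0 i = inord (h - s).
    by apply: val_inj; rewrite /= /bump inordK //=; lia.
  have [gi ngi] := cg i; rewrite Ei1 in gi; rewrite Ei in ngi.
  apply: (@indep_mod_adjoin _ pchar0 _ _ (comp_mpoly w) _ (c (inord (h - s)))).
  - by apply: (c_incr _ _ _).1; rewrite !inordK //; lia.
  - by rewrite /= wR.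
  - by rewrite /= wR.
  by apply: IHs; lia.
have ind0 : indep_mod (relation_ideal w) (D 0%N).
  move=> F /eqP Fw sF; apply: (indD h) => //; last by rewrite subnn.
  by rewrite inE Fw rpred0.
have := indep_mod_card ind0; rewrite /D cardsU disjoint_setI0 ?cards0 ?subn0.
  rewrite !card_imset; [|exact: rshift_inj|exact: lshift_inj].
  have -> : [set i : 'I_h | 0 <= i]%N = setT by apply/setP => i; rewrite !inE.
  by rewrite cardsT card_ord.
apply/pred0P => j /=; apply/negP => /andP[/imsetP[a _ ->] /imsetP[b _ /eqP]].
by rewrite eq_lrshift.
Qed.

Section Chain.
Variables (m n : nat) (f : m.-tuple {mpoly k[n]}).

Definition embed_l (p : {mpoly k[n]}) : {mpoly k[n + m]} :=
  p \mPo [tuple 'X_(lshift m i) | i < n].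

(** The point of [k[x_1, .., x_n, Z_1, .., Z_m] ^ m] whose relations form the
    prime [P_A]. *)
Definition generic_point (A : {set 'I_m}) : m.-tuple {mpoly k[n + m]} :=
  [tuple if j \in A then embed_l (tnth f j) else 'X_(rshift n j) | j < m].

Definition specialization (A : {set 'I_m}) : (n + m).-tuple {mpoly k[n + m]} :=
  cat_tuple [tuple 'X_(lshift m i) | i < n] (generic_point A).

Lemma embed_l_specialize A p : embed_l p \mPo specialization A = embed_l p.
Proof.
rewrite /embed_l comp_comp_mpoly; congr comp_mpoly; apply: eq_from_tnth => i.
by rewrite !tnth_mktuple comp_mpoly_var tnth_lshift tnth_mktuple.
Qed.

Lemma generic_point_specialize (A A' : {set 'I_m}) F : A \subset A' ->
  (F \mPo generic_point A) \mPo specialization A' = F \mPo generic_point A'.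
Proof.
move=> AA'; rewrite comp_comp_mpoly; congr comp_mpoly.
apply: eq_from_tnth => j; rewrite tnth_mktuple [in LHS]tnth_mktuple.
have [jA|jA] := boolP (j \in A).
  by rewrite embed_l_specialize tnth_mktuple (subsetP AA').
by rewrite comp_mpoly_var tnth_rshift.
Qed.

Lemma embed_l_eq0 p : (embed_l p == 0) = (p == 0).
Proof.
apply/eqP/eqP => [p0|->]; last exact: comp_mpoly0.
pose r := cat_tuple [tuple 'X_i | i < n] [tuple (0 : {mpoly k[n]}) | i < m].
have := congr1 (comp_mpoly r) p0; rewrite comp_mpoly0 comp_comp_mpoly => <-.
rewrite -[LHS]comp_mpoly_id; congr comp_mpoly; apply: eq_from_tnth => i.
by rewrite !tnth_mktuple comp_mpoly_var tnth_lshift tnth_mktuple.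
Qed.

Lemma relation_generic_supported (A : {set 'I_m}) F : supported A F ->
  (F \in relation_ideal (generic_point A)) = (F \in relation_ideal f).
Proof.
move=> sF; rewrite !unfold_in -embed_l_eq0 /embed_l comp_comp_mpoly.
congr (_ == 0); apply: (supported_eq_comp pchar0 sF) => j jA.
by rewrite !tnth_mktuple jA.
Qed.

Lemma relation_genericT : relation_ideal (generic_point setT) =i relation_ideal f.
Proof.
by move=> F; rewrite relation_generic_supported //; apply: supportedT.
Qed.

Lemma relation_genericS (A A' : {set 'I_m}) : A \subset A' ->
  {subset relation_ideal (generic_point A) <= relation_ideal (generic_point A')}.
Proof.
move=> AA' F /eqP F0; apply/eqP.
by rewrite -(generic_point_specialize _ AA') F0 comp_mpoly0.
Qed.

(** Differentiate the relation in the variable [Z_v]: it occurs in the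
    coordinate [v] of the generic point only. *)
Lemma relation_generic_mderiv (A : {set 'I_m}) F v : v \notin A ->
  F \in relation_ideal (generic_point A) ->
  F^`M(v) \in relation_ideal (generic_point A).
Proof.
move=> vA /eqP F0; apply/eqP; rewrite -[RHS](mderiv0 _ (rshift n v)) -F0.
rewrite mderiv_comp (bigD1 v) //= big1 ?addr0 => [|j jv]; rewrite tnth_mktuple.
  by rewrite (negPf vA) mderiv_var eqxx mulr1.
case: ifP => _.
  rewrite mderiv_comp big1 ?mulr0 // => i _.
  by rewrite tnth_mktuple mderiv_var eq_lrshift mulr0.
by rewrite mderiv_var (inj_eq (@rshift_inj _ _)) (negPf jv) mulr0.
Qed.

Lemma prime_chain_ex (B : {set 'I_m}) :
  indep_mod (relation_ideal f) B ->
  (forall v, v \notin B -> ~ indep_mod (relation_ideal f) (v |: B)) ->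
  prime_chain_to (relation_ideal f) #|~: B|.
Proof.
move=> indB maxB; set h := #|~: B|.
pose A i := B :|: [set j in ~: B | index j (enum (~: B)) < i]%N.
exists (fun i : 'I_h.+1 => relation_ideal (generic_point (A i)) : prime_idealr _).
split; last first.
  suff -> : A (@ord_max h) = setT by exact: relation_genericT.
  apply/setP => j; rewrite !inE; case: (boolP (j \in B)) => //= jB.
  by rewrite /= /h cardE index_mem mem_enum inE jB.
move=> i j ij; have AS : A i \subset A j.
  apply/subsetP => v; rewrite !inE => /orP[->//|/andP[-> vi]].
  by rewrite (leq_trans vi) ?orbT // ltnW.
split; first exact: relation_genericS.
have [v vA' vA] : exists2 v, v \in A j & v \notin A i.
  have hi : (i < size (enum (~: B)))%N.
    by rewrite -cardE (leq_trans ij) // -ltnS ltn_ord.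
  have m0 : 'I_m by case: (enum (~: B)) hi.
  pose v := nth m0 (enum (~: B)) i.
  have vB : v \in ~: B by rewrite -mem_enum mem_nth.
  have vi : index v (enum (~: B)) = i by rewrite index_uniq ?enum_uniq.
  exists v; first by rewrite inE inE vB vi ij orbT.
  by move: vB; rewrite !inE vi ltnn andbF orbF.
have vB : v \notin B by apply: contra vA; rewrite inE => ->.
have [G [QG sG nG]] := minimal_relation indB (maxB v vB).
have sGA : supported (A j) G.
  apply: supportedS sG; apply/subsetP => u; rewrite in_setU1 => /orP[/eqP -> //|uB].
  by rewrite inE uB.
move=> jsubi; case/negP: nG; rewrite -relation_genericT.
apply: relation_genericS (subsetT (A i)) _ _; apply: relation_generic_mderiv => //.
by apply: jsubi; rewrite relation_generic_supported.
Qed.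

End Chain.
End Height.

(** * Rank of a module without torsion *)

Section Rank.
Variable R : idomainType.
Local Notation K := {fraction R}.
Local Notation frac := (@tofrac R).

Lemma fractionP (c : K) : exists2 s, s != 0 & exists r, frac s * c = frac r.
Proof.
elim/quotW: c => x; exists (\d_x); first exact: denom_ratioP.
exists (\n_x); rewrite !piE /FracField.mulf /= !numden_Ratio ?oner_eq0 //.
apply/eqP; rewrite !mul1r piE /FracField.equivf /=.
by rewrite !numden_Ratio ?oner_eq0 ?denom_ratioP // mulr1.
Qed.

Lemma common_denominator d (v : 'rV[K]_d) :
  exists2 s, s != 0 & exists b, frac s *: v = map_mx frac b.
Proof.
have /choice[s sP] : forall j, exists s, s != 0 /\ exists r, frac s * v 0 j = frac r.
  by move=> j; have [s s0 rP] := fractionP (v 0 j); exists s.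
have /choice[r rP] : forall j, exists r, frac (s j) * v 0 j = frac r.
  by move=> j; have [_] := sP j.
exists (\prod_j s j); first by apply/prodf_neq0 => j _; have [] := sP j.
exists (\row_j (r j * \prod_(i | i != j) s i)); apply/rowP => j.
by rewrite !mxE (bigD1 j) //= !rmorphM /= -rP mulrAC.
Qed.

Section TorsionFree.
Variables (M : lmodType R) (V : lmodType K) (emb : {additive M -> V}).
Hypothesis embZ : forall r x, emb (r *: x) = frac r *: emb x.
Hypothesis emb_inj : injective emb.
Hypothesis emb_gen : forall v, exists2 s, s != 0 & exists x, frac s *: v = emb x.

(** Every [v] is a fraction [s^-1 *: emb x], so a balanced map [b] can only
    induce [v |-> b x (1/s)]; as [emb] is injective this does not depend on the
    fraction chosen. *)
Lemma torsion_free_tensor : is_tensor_frac (fun x c => c *: emb x).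
Proof.
split=> [|a x c|W b [bDl bDr bZ]]; last 1 first.
- have /choice[s sP] : forall v, exists s, s != 0 /\ exists x, frac s *: v = emb x.
    by move=> v; have [s s0 ?] := emb_gen v; exists s.
  have /choice[x xP] : forall v, exists x, frac (s v) *: v = emb x.
    by move=> v; have [_] := sP v.
  have s0 v : s v != 0 by have [] := sP v.
  have fr0 r : r != 0 -> frac r != 0 by rewrite tofrac_eq0.
  pose h v := b (x v) (frac (s v))^-1.
  have hE v t y : t != 0 -> frac t *: v = emb y -> h v = b y (frac t)^-1.
    move=> t0 ty; have Exy : t *: x v = s v *: y.
      by apply: emb_inj; rewrite !embZ -xP -ty !scalerA mulrC.
    have E1 : (frac (s v))^-1 = frac t * (frac t * frac (s v))^-1.
      by rewrite invfM mulVKf ?fr0.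
    have E2 : (frac t)^-1 = frac (s v) * (frac t * frac (s v))^-1.
      by rewrite mulrC invfM mulfVK ?fr0.
    by rewrite /h E1 -bZ Exy bZ -E2.
  have hD : zmod_morphism h.
    have addh u v : h (u + v) = h u + h v.
      have st0 : s u * s v != 0 by rewrite mulf_neq0.
      rewrite (hE _ _ (s v *: x u + s u *: x v) st0); last first.
        rewrite (raddfD emb) !embZ -!xP scalerDr !scalerA !tofracM.
        by congr (_ *: _ + _); rewrite mulrC.
      rewrite bDl !bZ /h tofracM; congr (b _ _ + b _ _).
        by rewrite mulrC invfM mulfVK ?fr0.
      by rewrite invfM mulVKf ?fr0.
    by move=> u v; apply/eqP; rewrite eq_sym subr_eq -addh subrK.
  pose hA := HB.pack_for {additive V -> W} h (GRing.isZmodMorphism.Build V W h hD).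
  exists hA => [y c|h' h'P v] /=.
    have [t t0 [r tr]] := fractionP c.
    rewrite (hE _ t (r *: y)) //; last by rewrite scalerA tr embZ.
    by rewrite bZ -tr mulrAC mulfV ?mul1r // fr0.
  have Ev : v = (frac (s v))^-1 *: emb (x v).
    by rewrite -xP scalerA mulVf ?fr0 // scale1r.
  by rewrite {1}Ev h'P.
- split=> [x y c|x c d|r x c]; rewrite ?raddfD ?scalerDr ?scalerDl //=.
  by rewrite embZ scalerA mulrC.
by rewrite scalerA.
Qed.
End TorsionFree.

(** The space of coordinates in the basis formed by the rows of [P] serves as
    the tensor product; clearing denominators in the coordinates of a vector
    brings it into the submodule. *)
Lemma has_rank_basis m d (A : submodClosed 'rV[R]_m) (P : 'M[R]_(d, m)) :
  (forall i, row i P \in A) -> row_free (map_mx frac P) ->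
  (forall a, a \in A -> (map_mx frac a <= map_mx frac P)%MS) ->
  has_rank (submodule A) d.
Proof.
move=> PA freeP AP; set W := map_mx frac P in freeP AP.
pose crd (x : submodule A) : 'rV[K]_d := map_mx frac (val x) *m pinvmx W.
have crdK x : crd x *m W = map_mx frac (val x).
  by rewrite mulmxKpV // AP //; apply: valP.
have crdB : zmod_morphism crd.
  by move=> x y; rewrite /crd -mulmxBl -map_mxB -[val (x - y)]/(val x - val y).
pose emb := HB.pack_for {additive (submodule A) -> 'rV[K]_d} crd
  (GRing.isZmodMorphism.Build (submodule A) 'rV[K]_d crd crdB).
exists 'rV[K]_d, (fun x c => c *: emb x).
split; last by rewrite dimvf /dim /= mul1n.
apply: torsion_free_tensor => [r x|x y /= xy|v] /=.
- by rewrite /crd -[val _]/(r *: val x) map_mxZ scalemxAl.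
- apply/val_inj/rowP => i; have := congr1 (fun r => (r *m W) 0 i) xy.
  by rewrite !crdK !mxE => /eqP; rewrite tofrac_eq => /eqP.
have [s s0 [b sb]] := common_denominator v; exists s => //.
have bP : b *m P \in A.
  by rewrite mulmx_sum_row; apply: rpred_sum => i _; apply: rpredZ.
by exists (Submodule bP); rewrite /crd /= map_mxM -sb -mulmxA mulmxVp // mulmx1.
Qed.

End Rank.

(** * Syzygies and the Jacobian matrix *)

Section Jacobian.
Variables (k : fieldType) (pchar0 : [pchar k]%R =i pred0) (n : nat).
Local Notation R := {mpoly k[n]}.
Local Notation K := {fraction R}.
Local Notation frac := (@tofrac R).

Definition jacobian m (f : m.-tuple R) : 'M[K]_(m, n) :=
  \matrix_(j, i) frac (mderiv i (tnth f j)).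

Lemma diff_syz_jacobian m (f : m.-tuple R) r :
  (r \in diff_syz f) = (map_mx frac r *m jacobian f == 0).
Proof.
have E i : (map_mx frac r *m jacobian f) 0 i =
    frac (\sum_(j < m) r 0 j * mderiv i (tnth f j)).
  by rewrite mxE rmorph_sum; apply: eq_bigr => j _; rewrite rmorphM !mxE.
apply/forallP/eqP => [Zr|Jr i].
  by apply/rowP => i; rewrite E (eqP (Zr i)) rmorph0 mxE.
by rewrite -tofrac_eq0 -E Jr mxE.
Qed.

Lemma polar_diff_syz m (f : m.-tuple R) F :
  F \in relation_ideal f -> polar_vec f F \in diff_syz f.
Proof.
move=> /eqP Ff; apply/forallP => i; apply/eqP.
have := mderiv_comp f i F; rewrite Ff mderiv0 => /esym; apply: etrans.
by apply: eq_bigr => j _; rewrite mxE.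
Qed.

Lemma polar_syz_sub m (f : m.-tuple R) r :
  r \in polar_syz f -> r \in diff_syz f.
Proof.
move=> /asboolP[s sP ->]; rewrite big_seq; apply: rpred_sum => a /sP[F QF ->].
by apply: rpredZ; apply: polar_diff_syz.
Qed.

Lemma polar_vec_supported m (f : m.-tuple R) D F j :
  supported D F -> j \notin D -> polar_vec f F 0 j = 0.
Proof. by move=> sF jD; rewrite mxE sF // comp_mpoly0. Qed.

(** The polar syzygy of a minimal relation expresses [df_v] through the [df_l],
    [l \in D]. *)
Lemma row_jacobian_sub m (f : m.-tuple R) D :
  indep_mod (relation_ideal f) D ->
  (forall v, v \notin D -> ~ indep_mod (relation_ideal f) (v |: D)) ->
  forall v, (row v (jacobian f) <= \sum_(l in D) <<row l (jacobian f)>>)%MS.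
Proof.
move=> indD maxD v; have [vD|vD] := boolP (v \in D).
  by rewrite (sumsmx_sup v) // genmxE.
have [G [QG sG nG]] := minimal_relation indD (maxD v vD).
have := polar_diff_syz QG; rewrite diff_syz_jacobian mulmx_sum_row.
pose c l := frac (polar_vec f G 0 l).
have -> : \sum_i map_mx frac (polar_vec f G) 0 i *: row i (jacobian f)
    = \sum_i c i *: row i (jacobian f).
  by apply: eq_bigr => i _; rewrite mxE.
rewrite (bigD1 v) //= addr_eq0 => /eqP Ev.
have cv : c v != 0 by rewrite tofrac_eq0 mxE.
rewrite -(eqmx_scale _ cv) Ev eqmx_opp; apply: summx_sub => l lv.
have [lD|lD] := boolP (l \in D).
  by rewrite (sumsmx_sup l) // genmxE scalemx_sub.
rewrite /c (polar_vec_supported _ sG) ?tofrac0 ?scale0r ?sub0mx //.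
by rewrite !inE negb_or lv.
Qed.

Lemma jacobian_rank m (f : m.-tuple R) (B : {set 'I_m}) :
  indep_mod (relation_ideal f) B -> (#|B| <= \rank (jacobian f))%N.
Proof.
move=> indB; pose v := cat_tuple f [tuple 'X_i | i < n].
have indBv : indep_mod (relation_ideal v) (lshift n @: B).
  exact: indep_mod_lshift.
have [D [BD indD maxD]] := indep_mod_maximal indBv.
have spanD := row_jacobian_sub indD maxD.
set L := lshift n @: B in BD.
have cardL : #|L| = #|B| by rewrite card_imset //; apply: lshift_inj.
pose E := D :\: L.
have full : (1%:M <= jacobian f + \sum_(l in E) <<row l (jacobian v)>>)%MS.
  apply/row_subP => i; rewrite rowE mulmx1.
  have -> : delta_mx 0 i = row (rshift m i) (jacobian v).
    apply/rowP => j; rewrite !mxE tnth_rshift tnth_mktuple mderiv_var.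
    by rewrite eqxx [j == i]eq_sym rmorph_nat.
  apply: submx_trans (spanD _) _; apply/sumsmx_subP => l lD; rewrite genmxE.
  have [/imsetP[j _ ->]|lL] := boolP (l \in L).
    have -> : row (lshift n j) (jacobian v) = row j (jacobian f).
      by apply/rowP => i'; rewrite !mxE tnth_lshift.
    by rewrite (submx_trans (row_sub _ _)) // addsmxSl.
  apply: submx_trans (addsmxSr _ _).
  by rewrite (sumsmx_sup l) ?genmxE // inE lL.
have := mxrankS full; rewrite mxrank1.
have rkE : (\rank (\sum_(l in E) <<row l (jacobian v)>>)%MS <= #|E|)%N.
  apply: leq_trans (mxrank_sum_leqif _).1 _.
  by rewrite /= -sum1_card; apply: leq_sum => l _; rewrite genmxE rank_leq_row.
have := (mxrank_adds_leqif (jacobian f)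
  (\sum_(l in E) <<row l (jacobian v)>>)%MS).1.
have := indep_mod_card indD; have := subset_leq_card BD.
have := cardsDS BD; rewrite -/E cardL; lia.
Qed.

Lemma syzygy_basis m (f : m.-tuple R) (B : {set 'I_m}) :
  indep_mod (relation_ideal f) B ->
  (forall v, v \notin B -> ~ indep_mod (relation_ideal f) (v |: B)) ->
  exists P : 'M[R]_(#|~: B|, m),
  [/\ forall i, row i P \in polar_syz f, row_free (map_mx frac P)
    & forall r, r \in diff_syz f -> (map_mx frac r <= map_mx frac P)%MS].
Proof.
move=> indB maxB; pose y (i : 'I_#|~: B|) : 'I_m := enum_val i.
have yB i : y i \notin B by have := enum_valP i; rewrite inE.
have /choice[G GP] : forall i, exists G, [/\ G \in relation_ideal f,
    supported (y i |: B) G & G^`M(y i) \notin relation_ideal f].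
  by move=> i; apply: minimal_relation => //; apply: maxB.
pose P : 'M[R]_(#|~: B|, m) := \matrix_i polar_vec f (G i).
have PE i j : P i j = polar_vec f (G i) 0 j by rewrite mxE.
have freeP : row_free (map_mx frac P).
  (* the columns y i of P form a diagonal matrix without zeros on the diagonal *)
  rewrite -kermx_eq0; apply/rowV0P => c /sub_kermxP cP; apply/rowP => i.
  have := congr1 (fun A : 'rV_m => A 0 (y i)) cP; rewrite !mxE (bigD1 i) //= big1.
    rewrite addr0 => /eqP; rewrite mulf_eq0 => /orP[/eqP //|].
    by rewrite mxE tofrac_eq0 PE mxE => Gi; have [_ _ /negP] := GP i.
  move=> l li; have [_ sG _] := GP l.
  rewrite mxE PE (polar_vec_supported _ sG) ?tofrac0 ?mulr0 //.
  by rewrite !inE negb_or yB andbT (inj_eq enum_val_inj) eq_sym.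
exists P; split=> // [i|r].
  rewrite rowK; apply/asboolP; exists [:: (1, polar_vec f (G i))].
    by move=> a; rewrite inE => /eqP ->; exists (G i) => //; have [] := GP i.
  by rewrite big_seq1 scale1r.
rewrite diff_syz_jacobian => /eqP/sub_kermxP rJ; apply: submx_trans rJ _.
have PJ : (map_mx frac P <= kermx (jacobian f))%MS.
  apply/row_subP => i; apply/sub_kermxP/eqP; rewrite -map_row rowK.
  by rewrite -diff_syz_jacobian; apply: polar_diff_syz; have [] := GP i.
(* the inclusion PJ is an equality of row spaces, by dimension *)
rewrite -(geq_leqif (mxrank_leqif_sup PJ)) mxrank_ker (eqP freeP).
have := jacobian_rank indB; have := cardsC B; rewrite card_ord; lia.
Qed.

End Jacobian.

Theorem lemma2p3 (k : fieldType) (pchar0 : [pchar k]%R =i pred0) (n m : nat)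
    (f : m.-tuple {mpoly k[n]}) :
  exists d : nat,
    [/\ has_rank (submodule (polar_syz f)) d,
        has_rank (submodule (diff_syz f)) d
      & has_height (relation_ideal f) d].
Proof.
have ind0 : indep_mod (relation_ideal f) set0.
  move=> F /eqP Ff sF; have EF : F = (F@_0)%:MP.
    apply/mpolyP => e; rewrite mcoeffC; have [->|e0] := eqVneq e 0%MM.
      by rewrite mulr1.
    rewrite mulr0; apply/eqP; rewrite mcoeff_eq0.
    apply: contra e0 => eF; apply/eqP/mnmP => j.
    by rewrite mnm0E (supported_msupp pchar0 sF eF) // inE.
  by move: Ff; rewrite EF comp_mpolyC => /eqP; rewrite mpolyC_eq0 => /eqP ->.
have [B [_ indB maxB]] := indep_mod_maximal ind0.
have [P [PA freeP spanP]] := syzygy_basis pchar0 indB maxB.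
exists #|~: B|; split.
- by apply: (has_rank_basis PA freeP) => r /polar_syz_sub; apply: spanP.
- by apply: (has_rank_basis _ freeP spanP) => i; apply: polar_syz_sub.
split; first exact: prime_chain_ex.
move=> h /(prime_chain_le pchar0 indB); have := cardsC B; rewrite card_ord; lia.
Qed.
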